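(* Let $N$ be an infinite, finitely generated nilpotent group such that $N/T(N)$ is abelian. Then $$\mathrm{F}_{N}(n) \approx \log(n).$$
   Context: $\mathbb{N}=\{1,2,3,\dots\}$. For a finitely generated nilpotent group $N$, $T(N)=\{g\in N : g \text{ has finite order}\}$ is the torsion subgroup (a finite characteristic subgroup). For a finitely generated group $G$ and $g\in G\setminus\{1\}$ let $\mathrm{D}_G(g)=\min\{|Q| : \varphi:G\to Q \text{ is a group homomorphism}, |Q|<\infty, \varphi(g)\neq 1\}$ (and $\infty$ if no such $Q$ exists). $G$ is residually finite if $\mathrm{D}_G(g)<\infty$ for all $g\ne 1$; finitely generated nilpotent groups are residually finite. For a residually finite group $G$ with finite generating set $S$ and word length $\|\cdot\|_S$, define $\mathrm{F}_{G,S}(n)=\max\{\mathrm{D}_G(g) : g\in G\setminus\{1\}, \|g\|_S\le n\}$. For nondecreasing functions $f,g$ of $n\in\mathbb{N}$, write $f\precsim g$ if there is a constant $C>0$ such that $f(n)\le C\,g(Cn)$ for all $n$, and $f\approx g$ if $f\precsim g$ and $g\precsim f$. Up to $\approx$, $\mathrm{F}_{G,S}$ does not depend on $S$, and one writes $\mathrm{F}_G$. *)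

(* Defs.v *)
From HB Require Import structures.
From mathcomp Require Import all_boot all_order all_algebra fingroup.
From mathcomp Require Import all_classical all_reals all_analysis.

Set Implicit Arguments.
Unset Strict Implicit.
Unset Printing Implicit Defensive.

Import Order.TTheory GRing.Theory Num.Theory.

Local Open Scope classical_set_scope.

(* MathComp's subgroup, nilpotency and quotient theory is restricted to finite
   groups, hence the following definitions over an arbitrary [groupType]. *)
Section Groups.
Local Open Scope group_scope.
Variable G : groupType.
Implicit Types (A B H S : set G) (g x y : G).

Definition is_subgroup H : Prop :=
  [/\ H 1, forall x y, H x -> H y -> H (x * y) & forall x, H x -> H x^-1].

Definition subgroup_generated A : set G := smallest is_subgroup A.

Definition generates S : Prop := subgroup_generated S = [set: G].

Definition finitely_generated : Prop :=
  exists S : set G, finite_set S /\ generates S.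

Fixpoint lower_central_series (i : nat) : set G :=
  if i is j.+1 then
    subgroup_generated [set z | exists x y, lower_central_series j x /\ z = [~ x, y]]
  else [set: G].

Definition nilpotent_group : Prop :=
  exists c : nat, lower_central_series c = [set 1].

Definition torsion : set G := [set g | exists n, (0 < n)%N /\ g ^+ n = 1].

Definition coset_by H x : set G := [set x * h | h in H].

Definition set_prod A B : set G := [set x * y | x in A & y in B].

(* The elements of G / H are the cosets xH, and they are multiplied as subsets
   of G; for H normal this is the group law (xH)(yH) = xyH. *)
Definition quotient_set H : set (set G) := range (coset_by H).

Definition abelian_quotient H : Prop :=
  forall A B, quotient_set H A -> quotient_set H B ->
    set_prod A B = set_prod B A.

Definition is_word S (w : seq G) : Prop :=
  forall s, s \in w -> S s \/ S s^-1.

Definition word_for S g (w : seq G) : Prop :=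
  is_word S w /\ \prod_(s <- w) s = g.

End Groups.

Section Growth.
Variable R : realType.
Local Open Scope ereal_scope.

(* Minimum of a set of natural numbers, +oo when the set is empty. *)
Definition ext_min (A : set nat) : \bar R := ereal_inf [set n%:R%:E | n in A].

Lemma ext_min_le (A : set nat) (n : nat) : A n -> ext_min A <= n%:R%:E.
Proof. by move=> An; apply: ereal_inf_lbound; exists n. Qed.

Lemma ext_min_attained (A : set nat) :
  A !=set0 -> exists2 n, A n & ext_min A = n%:R%:E.
Proof.
case=> a Aa; have exA : exists n, `[< A n >] by exists a; apply/asboolP.
case: (ex_minnP exA) => m /asboolP Am mmin; exists m => //.
apply/eqP; rewrite eq_le ext_min_le //=; apply: le_ereal_inf_tmp => _ [k Ak <-].
by rewrite lee_fin ler_nat; apply: mmin; apply/asboolP.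
Qed.

Lemma ext_min_set0 : ext_min set0 = +oo.
Proof. by rewrite /ext_min image_set0 ereal_inf0. Qed.

Variable G : groupType.

Definition word_length (S : set G) (g : G) : \bar R :=
  ext_min [set size w | w in word_for S g].

Definition divisibility (g : G) : \bar R :=
  ext_min [set n | exists (Q : finGroupType) (phi : {multiplicative G -> Q}),
                     phi g <> 1%g /\ n = #|Q|].

(* The supremum is a maximum over a finite ball as soon as [S] is finite. *)
Definition rf_growth (S : set G) (n : nat) : \bar R :=
  ereal_sup [set divisibility g
            | g in [set g | g <> 1%g /\ word_length S g <= n%:R%:E]].

End Growth.

Section Asymptotics.
Variable R : realType.
Local Open Scope ereal_scope.
Implicit Types f g : nat -> \bar R.

(* Functions of n = 1, 2, 3, ...; since they are nondecreasing, the constant C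
   may be taken to be a natural number, so that C * n is again an argument. *)
Definition growth_le f g : Prop :=
  exists C : nat, (0 < C)%N /\
    forall n : nat, (0 < n)%N -> f n <= C%:R%:E * g (C * n)%N.

Definition growth_equiv f g : Prop := growth_le f g /\ growth_le g f.

Definition log_growth (n : nat) : \bar R := (ln (n%:R : R))%:E.

End Asymptotics.

Arguments log_growth : clear implicits.
Arguments finitely_generated : clear implicits.
Arguments nilpotent_group : clear implicits.
Arguments torsion : clear implicits.
Arguments rf_growth R {G} S n.

(* Main.v *)
Require Import Defs.
From mathcomp Require Import all_boot all_order all_algebra fingroup cyclic.
From mathcomp Require Import all_classical all_reals all_analysis.
From HB Require Import structures.
From mathcomp Require Import zify ring lra.

(** Upper bound. The commutator subgroup [N, N] is finite: the factors of the
    lower central series after the first are finitely generated abelian groups,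
    and they are torsion because commutators are products of two torsion
    elements ([finite_commutator_subgroup]). Hence every element has finitely
    many conjugates, powers of the generators are central, and N is close to a
    free abelian group: there are finitely many homomorphisms psi_j from N to Z
    and one finite quotient F of N such that a nontrivial element of N killed by
    all psi_j survives in F ([homs_to_int_and_finite_quotient]). The elements
    that F detects cost a constant. For any other g of length at most n, some
    psi_j(g) is nonzero and of absolute value at most c n. By the Leibniz
    harmonic triangle an integer divisible by 1, ..., m+1 is at least 2^m, so the
    least q that does not divide psi_j(g) is O(log n), and g survives in Z/q.

    Lower bound. As N is infinite and F finite, some psi_j is nonzero, so N
    contains an element z of infinite order. Products of central binomial
    coefficients give a common multiple M of 1, ..., 2^k with M <= 4^(2^k), as
    in Chebyshev's estimates. A finite quotient in which z^M survives has more
    than 2^k elements, since otherwise the order of the image of z divides M;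
    and z^M has length at most M times that of z, so 2^k is of the order of the
    logarithm of the length. *)

Set Implicit Arguments.
Unset Strict Implicit.
Unset Printing Implicit Defensive.

Import Order.TTheory GRing.Theory Num.Theory.
Local Open Scope classical_set_scope.

(** * Subgroups and quotients *)

Section Subgroups.
Local Open Scope group_scope.
Variable G : groupType.
Implicit Types (A H : set G) (x y g : G).

Definition normalised H : Prop := forall x g, H x -> H (x ^ g).

Lemma subgroup_generated_subgroup A : is_subgroup (subgroup_generated A).
Proof.
split=> [|x y Ax Ay|x Ax] H HA; have [[H1 HM HV] _] := HA => //.
  by apply: HM; [apply: Ax|apply: Ay].
by apply: HV; apply: Ax.
Qed.

Lemma sub_subgroup_generated A : A `<=` subgroup_generated A.
Proof. by move=> x Ax H [_]; apply. Qed.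

Lemma subgroup_generated_min A H :
  is_subgroup H -> A `<=` H -> subgroup_generated A `<=` H.
Proof. by move=> sH AH x; apply. Qed.

Lemma generatesP A H : generates A -> is_subgroup H -> A `<=` H -> forall x, H x.
Proof.
move=> gA sH AH x; apply: (subgroup_generated_min sH AH).
by rewrite gA.
Qed.

Lemma subgroupX H x n : is_subgroup H -> H x -> H (x ^+ n).
Proof.
case=> H1 HM _ Hx; elim: n => [//|n IHn]; rewrite expgS; exact: HM.
Qed.

(** The carrier consists of chosen coset representatives rather than of cosets:
    a subtype of [G] inherits its choice structure. *)
Lemma quotient_group_exists H : is_subgroup H -> normalised H ->
  exists (Q : groupType) (pi : UMagmaMorphism.type G Q),
    (forall q, exists x, pi x = q) /\ (forall x, pi x = 1 <-> H x).
Proof.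
case=> H1 HM HV HJ.
pose same x := [pred y | `[< H (x^-1 * y) >]].
pose rep x := choose (same x) x.
have sameP x y : reflect (H (x^-1 * y)) (y \in same x) by exact: asboolP.
have same_rep x : H (x^-1 * rep x).
  by apply/sameP/chooseP; apply/sameP; rewrite mulVg.
have same_trans x y z : H (x^-1 * y) -> H (y^-1 * z) -> H (x^-1 * z).
  by move=> hxy hyz; have := HM _ _ hxy hyz; rewrite mulgA mulgK.
have same_sym x y : H (x^-1 * y) -> H (y^-1 * x).
  by move=> /HV; rewrite invgM invgK.
have repP x y : rep x = rep y <-> H (x^-1 * y).
  split=> [e|hxy].
    apply: (same_trans _ (rep x)) => //; rewrite e; exact: same_sym.
  rewrite /rep; have eqs : same x =1 same y.
    move=> z; apply/sameP/sameP; last exact: same_trans.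
    by apply: same_trans; apply: same_sym.
  rewrite (eq_choose eqs); apply: choose_id; apply/sameP => //.
    exact: same_sym.
  by rewrite mulVg.
have repM x y x' y' : rep x = rep x' -> rep y = rep y' -> rep (x * y) = rep (x' * y').
  move=> /repP hx /repP hy; apply/repP.
  have -> : (x * y)^-1 * (x' * y') = (y^-1 * y') * (x^-1 * x') ^ y'.
    by rewrite conjgE invgM !mulgA mulgK.
  by apply: HM => //; apply: HJ.
have repV x y : rep x = rep y -> rep x^-1 = rep y^-1.
  move=> /repP h; apply/repP; rewrite invgK.
  have -> : x * y^-1 = (((x^-1 * y) ^ x^-1)^-1).
    by rewrite -conjVg conjgE !invgM !invgK !mulgA mulgK.
  by apply/HV/HJ.
have rep_rep x : rep (rep x) = rep x by apply/repP/same_sym.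
pose T := {x : G | rep x == x}.
pose cl x : T := exist _ (rep x) (introT eqP (rep_rep x)).
have clP x y : cl x = cl y <-> rep x = rep y.
  by split=> [/(congr1 val)//|e]; apply: val_inj.
have clK (q : T) : cl (val q) = q by apply: val_inj; rewrite /= (eqP (valP q)).
pose one := cl 1; pose mul (p q : T) := cl (val p * val q).
pose inv (p : T) := cl (val p)^-1.
have mulE x y : mul (cl x) (cl y) = cl (x * y).
  by apply/clP; apply: repM; apply: rep_rep.
have invE x : inv (cl x) = cl x^-1 by apply/clP/repV/rep_rep.
have mA : associative mul.
  by move=> p q r; rewrite -(clK p) -(clK q) -(clK r) !mulE mulgA.
have m1 : left_id one mul by move=> p; rewrite -(clK p) mulE mul1g.
have m1' : right_id one mul by move=> p; rewrite -(clK p) mulE mulg1.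
have mV : left_inverse one inv mul by move=> p; rewrite -(clK p) invE mulE mulVg.
have mV' : right_inverse one inv mul
  by move=> p; rewrite -(clK p) invE mulE mulgV.
pose Q : groupType := HB.pack T (isGroup.Build T mA m1 m1' mV mV').
have clF : {morph (cl : G -> Q) : x y / x / y}.
  by move=> x y; rewrite -mulE -invE.
pose pi : UMagmaMorphism.type G Q :=
  HB.pack (cl : G -> Q) (isGroupMorphism.Build G Q cl clF).
exists Q, pi; split=> [q|x]; first by exists (val q); apply: clK.
split=> [/clP/repP|Hx]; first by rewrite mulg1 => /HV; rewrite invgK.
by apply/clP/repP; rewrite mulg1; apply: HV.
Qed.

End Subgroups.

(** A group with a finite carrier needs an enumeration of its elements before it
    can serve as a finite quotient. *)
Lemma finGroup_of_finite (Q : groupType) : finite_set [set: Q] ->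
  exists (F : finGroupType) (f : UMagmaMorphism.type Q F), injective f.
Proof.
move=> /finite_seqP[r rE].
have rax : finite_axiom (undup r).
  apply: Finite.uniq_enumP; first exact: undup_uniq.
  by move=> x; rewrite mem_undup; have : [set: Q] x by []; rewrite rE.
pose T := fin_type rax.
pose mul (x y : T) : T := ((x : Q) * (y : Q))%g.
pose inv (x : T) : T := ((x : Q)^-1)%g.
have mA : associative mul by exact: mulgA.
have m1 : left_id (1%g : Q) mul by exact: mul1g.
have mV : left_inverse (1%g : Q) inv mul by exact: mulVg.
pose F : finGroupType := HB.pack T (Finite_isGroup.Build T mA m1 mV).
have idF : {morph (id : Q -> F) : x y / (x / y)%g} by [].
pose f : UMagmaMorphism.type Q F :=
  HB.pack (id : Q -> F) (isGroupMorphism.Build Q F _ idF).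
by exists F, f.
Qed.

(** * Integer powers and products of powers of commuting elements *)

Section IntegerPowers.
Local Open Scope group_scope.
Variable G : groupType.
Implicit Types (x y : G) (a b : int).

Definition zpow x a : G :=
  match a with Posz n => x ^+ n | Negz n => x ^- n.+1 end.

(** Writing an exponent as a difference of naturals avoids the case analysis
    on signs when exponents are added. *)
Lemma zpowB x m n : zpow x (m%:Z - n%:Z)%R = x ^+ m * x ^- n.
Proof.
case: (leqP n m) => [nm|/ltnW mn]; first by rewrite subzn // /= expgnFr.
rewrite -opprB subzn //; have -> k : zpow x (- k%:Z)%R = x ^- k.
  by case: k => [|k]; rewrite ?oppr0 ?invg1 // -NegzE.
by rewrite expgnFr // invgF.
Qed.

Lemma zpowD x a b : zpow x (a + b)%R = zpow x a * zpow x b.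
Proof.
have diff c : exists p : nat * nat, c = (p.1%:Z - p.2%:Z)%R.
  case: c => n; first by exists (n, 0); rewrite subr0.
  by exists (0, n.+1); rewrite NegzE sub0r.
have [[m n] ->] := diff a; have [[p q] ->] := diff b.
have -> : (m%:Z - n%:Z + (p%:Z - q%:Z) = (m + p)%:Z - (q + n)%:Z)%R by lia.
rewrite !zpowB /= !expgnDr invgM !mulgA; congr (_ * _).
rewrite -!mulgA; congr (_ * _); exact/commuteV/commuteX2.
Qed.

Lemma zpow1 x : zpow x 1 = x. Proof. by []. Qed.

Lemma zpowN x a : zpow x (- a)%R = (zpow x a)^-1.
Proof. by apply/esym/mulg1_eq; rewrite -zpowD subrr. Qed.

Lemma zpow1g a : zpow 1 a = 1.
Proof. by case: a => k /=; rewrite expg1n ?invg1. Qed.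

Lemma zpowX x m a : zpow (x ^+ m) a = zpow x (m%:Z * a)%R.
Proof.
have nat_case k : zpow (x ^+ m) k%:Z = zpow x (m%:Z * k%:Z)%R.
  by rewrite -PoszM /= expgnA.
by case: a => k //; rewrite NegzE mulrN !zpowN nat_case.
Qed.

Lemma commute_zpow x y a : commute x y -> commute x (zpow y a).
Proof. by case: a => n xy /=; [|apply: commuteV]; apply: commuteX. Qed.

Lemma zpow_mod x (q : nat) a : x ^+ q = 1 -> zpow x a = zpow x (a %% q)%Z.
Proof.
move=> xq; by rewrite {1}(divz_eq a q) zpowD mulrC -zpowX xq zpow1g mul1g.
Qed.

Lemma finite_range_zpow x q : (0 < q)%N -> x ^+ q = 1 ->
  finite_set (range (zpow x)).
Proof.
move=> q_gt0 xq; apply: (@sub_finite_set _ _ ((fun n => x ^+ n) @` `I_q)).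
  move=> _ [a _ <-]; exists `|(a %% q)%Z|%N => /=.
    by have := ltz_pmod a (_ : (0 < q%:Z)%R); have := modz_ge0 a (_ : (q%:Z != 0)%R); lia.
  rewrite (zpow_mod a xq); have := modz_ge0 a (_ : (q%:Z != 0)%R).
  by case: (a %% q)%Z => //= k; lia.
exact/finite_image/finite_II.
Qed.

(** For commuting [s i] this is the homomorphism from the free abelian group
    of rank [n] that sends the standard basis to [s]; exponent vectors are
    functions on all of [nat], read below [n] only. *)
Definition powprod (s : nat -> G) n (v : nat -> int) : G :=
  \prod_(i < n) zpow (s i) (v i).

Lemma powprodS s n v : powprod s n.+1 v = powprod s n v * zpow (s n) (v n).
Proof. by rewrite /powprod big_ord_recr. Qed.

Lemma eq_powprod s n v w : (forall i, (i < n)%N -> v i = w i) ->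
  powprod s n v = powprod s n w.
Proof. by move=> vw; apply: eq_bigr => i _; rewrite vw. Qed.

Lemma powprod_eq0 s n v : (forall i, (i < n)%N -> v i = 0%R) -> powprod s n v = 1.
Proof. by move=> v0; apply: big1 => i _; rewrite v0. Qed.

Lemma powprodX s n m v :
  powprod (fun i => s i ^+ m) n v = powprod s n (fun i => m%:Z * v i)%R.
Proof. by apply: eq_bigr => i _; apply: zpowX. Qed.

Lemma powprod_delta s n i : (i < n)%N ->
  powprod s n (fun j => (j == i)%:Z)%R = s i.
Proof.
elim: n => // n IHn; rewrite ltnS leq_eqVlt powprodS.
case/orP=> [/eqP->|lt_in]; first by rewrite eqxx powprod_eq0 ?mul1g // => j /ltn_eqF->.
by rewrite IHn // gtn_eqF // mulg1.
Qed.

Lemma finite_range_powprod s n :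
  (forall i, (i < n)%N -> exists2 q, (0 < q)%N & s i ^+ q = 1) ->
  finite_set (range (powprod s n)).
Proof.
elim: n => [_|n IHn tors].
  apply: (@sub_finite_set _ _ [set 1]); last exact: finite_set1.
  by move=> _ [v _ <-]; rewrite /powprod big_ord0.
have [q q_gt0 sq] := tors n (ltnSn n).
apply: (@sub_finite_set _ _ [set x * y | x in range (powprod s n) & y in range (zpow (s n))]).
  move=> _ [v _ <-]; rewrite powprodS; exists (powprod s n v); first by exists v.
  by exists (zpow (s n) (v n)) => //; exists (v n).
apply: finite_image2; last exact: finite_range_zpow sq.
by apply: IHn => i /ltnW; apply: tors.
Qed.

Section Commuting.
Variables (s : nat -> G) (n : nat).
Hypothesis s_comm : forall i j, (i < n)%N -> (j < n)%N -> commute (s i) (s j).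

Lemma powprodD v w :
  powprod s n (fun i => v i + w i)%R = powprod s n v * powprod s n w.
Proof.
rewrite /powprod -prodgM_commute; first by apply: eq_bigr => i _; apply: zpowD.
move=> i j _ _; apply: commute_zpow; apply: commute_sym.
by apply: commute_zpow; apply: s_comm.
Qed.

Lemma powprodN v : powprod s n (fun i => - v i)%R = (powprod s n v)^-1.
Proof.
by apply/esym/mulg1_eq; rewrite -powprodD powprod_eq0 // => i _; apply: subrr.
Qed.

Lemma powprodMn v m :
  powprod s n (fun i => m%:Z * v i)%R = powprod s n v ^+ m.
Proof.
elim: m => [|m IHm]; first by rewrite powprod_eq0 // => i _; rewrite mul0r.
rewrite expgS -IHm -powprodD; apply: eq_powprod => i _.
by rewrite -addn1 PoszD mulrDl mul1r addrC.
Qed.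

Lemma powprodZ a v : powprod s n (fun i => a * v i)%R = zpow (powprod s n v) a.
Proof.
case: a => k; first exact: powprodMn.
rewrite NegzE zpowN -[zpow _ _]powprodMn -powprodN; apply: eq_powprod => i _.
by rewrite mulNr.
Qed.

Lemma range_powprod_subgroup : is_subgroup (range (powprod s n)).
Proof.
split=> [|_ _ [v _ <-] [w _ <-]|_ [v _ <-]].
- by exists (fun=> 0%R) => //; apply: powprod_eq0.
- by exists (fun i => v i + w i)%R => //; rewrite powprodD.
- by exists (fun i => - v i)%R => //; rewrite powprodN.
Qed.

End Commuting.
End IntegerPowers.

Lemma gmulf_zpow (G H : groupType) (f : UMagmaMorphism.type G H) x a :
  f (zpow x a) = zpow (f x) a.
Proof. by case: a => n /=; rewrite ?gmulfXVn ?gmulfXn. Qed.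

Lemma gmulf_powprod (G H : groupType) (f : UMagmaMorphism.type G H) s n v :
  f (powprod s n v) = powprod (f \o s) n v.
Proof. by rewrite gmulf_prod; apply: eq_bigr => i _; apply: gmulf_zpow. Qed.

(** * Integer functionals vanishing on a subgroup of a lattice *)

Section Lattice.
Local Open Scope ring_scope.
Implicit Types (K : set (nat -> int)) (v w : nat -> int).

Definition combination (a : int) v (b : int) w : nat -> int :=
  fun i => a * v i + b * w i.

Definition linear_functional (psi : (nat -> int) -> int) : Prop :=
  forall a v b w, psi (combination a v b w) = a * psi v + b * psi w.

(** Elimination of one coordinate at a time. If the last coordinate vanishes on
    [K], it is one of the functionals sought; otherwise a vector of [K] on which
    it is nonzero serves as a pivot, and [d] collects the pivots. Here Z^k is
    the quotient of [nat -> int] by the vectors whose first [k] coordinates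
    vanish, so that all ranks share one type. *)
Lemma functionals_of_sublattice k K :
  (forall a v b w, K v -> K w -> K (combination a v b w)) ->
  (forall v, (forall i, (i < k)%N -> v i = 0) -> K v) ->
  exists r (psi : nat -> (nat -> int) -> int) (d : nat),
    [/\ (0 < d)%N,
        forall j, linear_functional (psi j),
        forall j v, (j < r)%N -> K v -> psi j v = 0 &
        forall v, (forall j, (j < r)%N -> psi j v = 0) ->
          K (fun i => d%:Z * v i)].
Proof.
elim: k K => [|k IHk] K KL K0.
  exists 0%N, (fun _ _ => 0), 1%N; split=> // [j a v b w|v _]; first by rewrite !mulr0 addr0.
  exact: K0.
pose kill v : nat -> int := fun i => if i == k then 0 else v i.
pose K1 := [set v | K (kill v)].
have K1P v : v k = 0 -> K1 v <-> K v.
  move=> vk; rewrite /K1 /=; suff -> : kill v = v by [].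
  by apply/funext => i; rewrite /kill; case: eqVneq => [->|].
have [||r [psi [d [d_gt0 psiL psiK Kpsi]]]] := IHk K1.
- move=> a v b w; rewrite /K1 /= => Kv Kw; have := KL a _ b _ Kv Kw.
  congr K; apply/funext => i; rewrite /combination /kill.
  by case: ifP => _; rewrite ?mulr0 ?addr0.
- move=> v v0; apply: K0 => i; rewrite ltnS leq_eqVlt /kill.
  by case: eqVneq => //= _; apply: v0.
case: (pselect (exists2 u, K u & u k != 0)) => [[u Ku uk]|noK]; last first.
  exists r.+1, (fun j => if j is j'.+1 then psi j' else fun v => v k), d.
  have vk0 v : K v -> v k = 0 by move=> Kv; apply: contra_notP noK => /eqP vk; exists v.
  split=> // [[|j] //|[|j] v|v psi0]; first by move=> _; apply: vk0.
    by rewrite ltnS => jr Kv; apply: psiK => //; apply/K1P => //; apply: vk0.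
  have vk := psi0 0%N (ltn0Sn r).
  have /K1P : K1 (fun i => d%:Z * v i) by apply: Kpsi => j jr; apply: (psi0 j.+1).
  by apply; rewrite vk mulr0.
set t := u k in uk; pose reduce v := combination t v (- v k) u.
have reducek v : reduce v k = 0 by rewrite /reduce /combination -/t mulNr mulrC subrr.
exists r, (fun j v => psi j (reduce v)), (d * `|t|)%N; split.
- by rewrite muln_gt0 d_gt0 absz_gt0.
- move=> j a v b w; rewrite -psiL; congr (psi j _); apply/funext => i.
  by rewrite /reduce /combination; ring.
- move=> j v jr Kv; apply: psiK => //; apply/(K1P _ (reducek v)); exact: KL.
move=> v psi0; have /K1P Kdv : K1 (fun i => d%:Z * reduce v i) by apply: Kpsi.
have {}Kdv := Kdv (_ : d%:Z * reduce v k = 0).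
have := KL (Num.sg t) _ (Num.sg t * (d%:Z * v k)) _ (Kdv _) Ku.
rewrite reducek mulr0 => /(_ erefl); congr K; apply/funext => i.
by rewrite /combination /reduce /combination PoszM abszE normrEsg; ring.
Qed.

End Lattice.

(** * Divisors of small integers *)

Section SmallDivisors.
Local Open Scope nat_scope.

(** The reciprocals of [n.+1 * 'C(n, k)] form the Leibniz harmonic triangle,
    in which every entry is the difference of two entries nearer the edge;
    hence a common multiple of the edge entries 1, ..., [n.+1] is a multiple of
    all of them. *)
Lemma leibniz_triangle_dvdn M n k : (forall d, 0 < d <= n.+1 -> d %| M) ->
  k <= n -> n.+1 * 'C(n, k) %| M.
Proof.
elim: k n => [|k IHk] n dM kn; first by rewrite bin0 muln1 dM /=.
case: n dM kn => // n dM kn.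
have /dvdnP[a Ma] : n.+1 * 'C(n, k) %| M.
  by apply: IHk => // d /andP[d0 dn]; apply: dM; rewrite d0 ltnW.
have /dvdnP[b Mb] : n.+2 * 'C(n.+1, k) %| M by apply: IHk => //; apply: ltnW.
have eX : n.+1 * 'C(n, k) = k.+1 * 'C(n.+1, k.+1) by rewrite -mul_bin_diag.
have eY : n.+1 * 'C(n, k) = (n.+1 - k) * 'C(n.+1, k) by rewrite mul_bin_down.
have Y_gt0 : 0 < 'C(n.+1, k) by rewrite bin_gt0 ltnW.
have X_gt0 : 0 < 'C(n.+1, k.+1) by rewrite bin_gt0.
rewrite eX in Ma eY; move: Ma Mb eY X_gt0 Y_gt0.
move: 'C(n.+1, k.+1) 'C(n.+1, k) => X Y Ma Mb eY X0 Y0.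
apply/dvdnP; exists (a - b).
have aeq : a * (n.+1 - k) = b * n.+2.
  by apply/eqP; rewrite -(eqn_pmul2r Y0) -!mulnA -eY -Ma -Mb.
have -> : a - b = a * k.+1 %/ n.+2.
  have -> : a * k.+1 = (a - b) * n.+2 by rewrite mulnBl -aeq -mulnBr; congr (_ * _); lia.
  by rewrite mulnK.
rewrite mulnA divnK ?Ma ?mulnA //.
by apply/dvdnP; exists (a - b); rewrite mulnBl -aeq -mulnBr; congr (_ * _); lia.
Qed.

(** The [n.+1] entries of a row of the triangle sum to [n.+1 * 2 ^ n]. *)
Lemma exp2_le_of_dvdn M n : 0 < M -> (forall d, 0 < d <= n.+1 -> d %| M) ->
  2 ^ n <= M.
Proof.
move=> M_gt0 dM; rewrite -(@leq_pmul2l n.+1) // -[2]/(1 + 1) expnDn big_distrr /=.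
rewrite -[X in X * M]card_ord -sum_nat_const; apply: leq_sum => k _.
rewrite !exp1n !muln1; apply: dvdn_leq => //.
by apply: leibniz_triangle_dvdn; rewrite // -ltnS.
Qed.

Lemma exists_small_nondivisor M : 0 < M ->
  exists q, [/\ 1 < q, ~~ (q %| M) & 2 ^ q <= 4 * M].
Proof.
move=> M_gt0.
have exq : exists q, (0 < q) && ~~ (q %| M).
  by exists M.+1; apply/negP => /(dvdn_leq M_gt0); rewrite ltnn.
case: (ex_minnP exq) => q /andP[q_gt0 ndvd] qmin; exists q.
have q_gt1 : 1 < q by case: q q_gt0 ndvd {qmin} => [|[|q]]; rewrite ?dvd1n.
split=> //; case: q q_gt1 qmin {q_gt0 ndvd} => [|[|q]] // _ qmin.
rewrite !expnS mulnA leq_mul2l /=; apply: exp2_le_of_dvdn => // d /andP[d_gt0 dq].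
by apply: contraTT dq => ndvd; rewrite -ltnNge; apply: qmin; rewrite d_gt0.
Qed.

(** A substitute for the least common multiple of 1, ..., 2^k. Passing from 2^k
    to 2^(k+1) can raise the exponent of a prime in the least common multiple by
    one only, and a central binomial coefficient supplies all these primes. *)
Fixpoint common_multiple k : nat :=
  if k is j.+1 then common_multiple j * 'C(2 ^ j.+1, 2 ^ j) else 1.

Lemma common_multiple_gt0 k : 0 < common_multiple k.
Proof.
elim: k => //= k IHk; rewrite muln_gt0 IHk bin_gt0 leq_exp2l //; exact: leqnSn.
Qed.

Lemma bin_le_exp2 n m : 'C(n, m) <= 2 ^ n.
Proof.
case: (leqP m n) => [mn|nm]; last by rewrite bin_small.
rewrite -[2]/(1 + 1) expnDn (bigD1 (Ordinal (mn : m < n.+1))) //=.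
by rewrite !exp1n !muln1 leq_addr.
Qed.

Lemma common_multiple_le k : common_multiple k <= 4 ^ (2 ^ k).
Proof.
elim: k => //= k IHk; rewrite [X in 4 ^ X]expnS mul2n -addnn expnD.
by apply: leq_mul => //; rewrite (leq_trans (bin_le_exp2 _ _)) // expnS expnM.
Qed.

(** In Legendre's formula p^e contributes one to the exponent of p in the
    factorial of 2n and nothing for n, while the other powers of p contribute at
    least twice as much for 2n as for n. *)
Lemma prime_dvd_bin_double p e n : prime p -> n < p ^ e <= n.*2 ->
  p %| 'C(n.*2, n).
Proof.
move=> p_pr /andP[nq q2n].
have e_gt0 : 0 < e by case: e nq q2n => //; rewrite expn0; case: n => // -[].
have n2E : n.*2`! = 'C(n.*2, n) * (n`! * n`!).
  by rewrite -(@bin_fact n.*2 n) ?doubleK -?addnn ?leq_addr // addnK.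
have C_gt0 : 0 < 'C(n.*2, n) by rewrite bin_gt0 -addnn leq_addr.
rewrite -[p]expn1 pfactor_dvdn //.
have := congr1 (logn p) n2E; rewrite !lognM ?muln_gt0 ?fact_gt0 // logn_fact //.
have fact_n : logn p n`! = \sum_(1 <= k < n.*2.+1) n %/ p ^ k.
  rewrite logn_fact // [RHS](@big_cat_nat _ _ _ n.+1) //=; last by rewrite ltnS -addnn leq_addr.
  rewrite [X in _ = _ + X]big1_seq ?addn0 // => k /andP[_]; rewrite mem_index_iota => /andP[nk _].
  by rewrite divn_small // (ltn_trans nk) // ltn_expl // prime_gt1.
rewrite fact_n => e2.
suff : \sum_(1 <= k < n.*2.+1) (n %/ p ^ k + n %/ p ^ k) < \sum_(1 <= k < n.*2.+1) n.*2 %/ p ^ k.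
  by rewrite big_split /= e2; lia.
have e_in : e \in index_iota 1 n.*2.+1.
  rewrite mem_index_iota e_gt0 /= ltnS (leq_trans _ q2n) // ltnW // ltn_expl // prime_gt1 //.
rewrite (bigD1_seq e) ?iota_uniq //= [ltnRHS](bigD1_seq e) ?iota_uniq //=.
rewrite divn_small // -addSn; apply: leq_add.
  by rewrite divn_gt0 // expn_gt0 prime_gt0.
apply: leq_sum => k _; rewrite addnn -mul2n -[n.*2]mul2n.
by rewrite leq_divRL ?expn_gt0 ?prime_gt0 // -mulnA leq_mul2l leq_divM orbT.
Qed.

Lemma dvdn_common_multiple k d : 0 < d <= 2 ^ k -> d %| common_multiple k.
Proof.
elim: k d => [|k IHk] d /andP[d_gt0 dk]; first by case: d d_gt0 dk => [|[]].
apply/(dvdn_partP _ d_gt0) => p; rewrite mem_primes => /and3P[p_pr _ _].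
rewrite p_part; set e := logn p d.
have : p ^ e <= 2 ^ k.+1 by rewrite (leq_trans _ dk) // dvdn_leq // pfactor_dvdnn.
case: (leqP (p ^ e) (2 ^ k)) => [le_q _|lt_q q_le].
  by rewrite /= dvdn_mulr // IHk // expn_gt0 prime_gt0.
have e_gt0 : 0 < e by case: (e) lt_q => //; rewrite expn0 ltnNge expn_gt0.
rewrite -(prednK e_gt0) expnSr /=; apply: dvdn_mul.
  apply: IHk; rewrite expn_gt0 prime_gt0 //= -(@leq_pmul2l 2) // -expnS (leq_trans _ q_le) //.
  by rewrite -[in leqRHS](prednK e_gt0) expnS leq_mul2r prime_gt1 ?orbT.
rewrite expnS mul2n; apply: (@prime_dvd_bin_double _ e) => //.
by rewrite lt_q -mul2n -expnS.
Qed.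

End SmallDivisors.

(** * Finiteness of the commutator subgroup *)

Section CommutatorIdentities.
Local Open Scope group_scope.
Variable G : groupType.
Implicit Types x y z : G.

Lemma commMgJ x y z : [~ x * y, z] = [~ x, z] ^ y * [~ y, z].
Proof. by rewrite !commgEr conjgM mulgA -conjMg mulgK. Qed.

Lemma commgMJ x y z : [~ x, y * z] = [~ x, z] * [~ x, y] ^ z.
Proof. by rewrite !commgEl conjgM -mulgA -conjMg mulVKg. Qed.

Lemma commVgJ x y : [~ x^-1, y] = ([~ x, y] ^ x^-1)^-1.
Proof. by apply/esym/mulg1_eq; rewrite -commMgJ mulgV comm1g. Qed.

Lemma commgVJ x y : [~ x, y^-1] = ([~ x, y] ^ y^-1)^-1.
Proof.
by rewrite -[LHS]invgK; congr (_^-1); apply: mulg1_eq; rewrite -commgMJ mulgV commg1.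
Qed.

Lemma commXg x y n : commute [~ x, y] x -> [~ x ^+ n, y] = [~ x, y] ^+ n.
Proof.
move=> c; elim: n => [|n IHn]; first exact: comm1g.
rewrite !expgSr commMgJ IHn; congr (_ * _).
by apply/conjg_fixP/commgP/commute_sym/commuteX/commute_sym.
Qed.

End CommutatorIdentities.

Section LowerCentralSeries.
Local Open Scope group_scope.
Variable G : groupType.
Local Notation L := (@lower_central_series G).
Implicit Types (x y z g : G) (S X : set G).

Lemma lcs_subgroup j : is_subgroup (L j).
Proof. by case: j => [|j]; [split|apply: subgroup_generated_subgroup]. Qed.

Lemma lcs_commg j x y : L j x -> L j.+1 [~ x, y].
Proof. by move=> Lx; apply: sub_subgroup_generated; exists x, y. Qed.

Lemma lcs_le j : L j.+1 `<=` L j.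
Proof.
elim: j => [//|j IHj]; apply: subgroup_generated_min; first exact: lcs_subgroup.
by move=> _ [x [y [/IHj Lx ->]]]; apply: lcs_commg.
Qed.

Lemma lcs_normalised j : normalised (L j).
Proof.
move=> x g Lx; have -> : x ^ g = x * [~ x, g] by rewrite commgEl mulVKg.
have [_ LM _] := lcs_subgroup j; apply: LM => //; apply: lcs_le; exact: lcs_commg.
Qed.

Lemma lcs_quotient j : exists (Q : groupType) (pi : UMagmaMorphism.type G Q),
  [/\ forall q, exists x, pi x = q, forall x, pi x = 1 <-> L j.+1 x &
      forall x y, L j x -> commute (pi x) (pi y)].
Proof.
have [Q [pi [pi_surj piK]]] :=
  quotient_group_exists (lcs_subgroup j.+1) (@lcs_normalised j.+1).
exists Q, pi; split=> // x y Lx; apply/commgP/eqP; rewrite -gmulfR.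
by apply/piK; apply: lcs_commg.
Qed.

Lemma lcs_torsion_of_commutators j :
  (forall x y, L j x -> exists2 m, (0 < m)%N & L j.+2 ([~ x, y] ^+ m)) ->
  forall x, L j.+1 x -> exists2 m, (0 < m)%N & L j.+2 (x ^+ m).
Proof.
move=> tors x Lx.
have [Q [pi [_ piK pi_comm]]] := lcs_quotient j.+1.
have [L1 LM LV] := lcs_subgroup j.+1.
pose U z := L j.+1 z /\ exists2 m, (0 < m)%N & L j.+2 (z ^+ m).
suff : U x by case.
apply: (subgroup_generated_min _ _ Lx); last first.
  by move=> _ [y [z [Ly ->]]]; split; [apply: lcs_commg|apply: tors].
split=> [|y z [Ly [m m0 ym]] [Lz [n n0 zn]]|y [Ly [m m0 ym]]].
- split=> //; exists 1%N => //; by case: (lcs_subgroup j.+2).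
- split; first exact: LM.
  exists (m * n)%N; first by rewrite muln_gt0 m0.
  move: ym zn => /piK ym /piK zn; apply/piK.
  rewrite gmulfXn gmulfM expgMn; last exact: pi_comm.
  rewrite expgnA -gmulfXn ym expg1n mul1g mulnC expgnA -gmulfXn zn.
  exact: expg1n.
- split; first exact: LV.
  exists m => //; rewrite expVgn; case: (lcs_subgroup j.+2) => _ _; exact.
Qed.

Hypothesis commg_torsion : forall x y,
  exists t u, [/\ torsion G t, torsion G u & [~ x, y] = t * u].

(** A product of two elements of finite order has finite order as soon as it is
    central, which settles the first factor; deeper in the series, the m-th power
    of the commutator of x and y is the commutator of x^m and y modulo the next
    term. *)
Lemma lcs_torsion j x : L j.+1 x -> exists2 m, (0 < m)%N & L j.+2 (x ^+ m).
Proof.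
elim: j x => [|j IHj]; apply: lcs_torsion_of_commutators => x y Lx.
  have [t [u [[m [m0 tm]] [n [n0 un]] xy]]] := commg_torsion x y.
  have [Q [pi [_ piK pi_comm]]] := lcs_quotient 1.
  exists (m * n)%N; first by rewrite muln_gt0 m0.
  apply/piK; have pit : pi t = pi [~ x, y] * pi u^-1 by rewrite -gmulfM xy mulgK.
  have : pi t ^+ (m * n) = 1 by rewrite -gmulfXn expgnA tm expg1n gmulf1.
  rewrite pit expgMn; last by apply: pi_comm; apply: lcs_commg.
  by rewrite -!gmulfXn expVgn mulnC [u ^+ _]expgnA un expg1n invg1 gmulf1 mulg1.
have [m m0 xm] := IHj x Lx; exists m => //.
have [Q [pi [_ piK pi_comm]]] := lcs_quotient j.+2.
apply/piK; rewrite gmulfXn gmulfR -commXg; last first.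
  by rewrite -gmulfR; apply: pi_comm; apply: lcs_commg.
by rewrite -gmulfXn -gmulfR; apply/piK; apply: lcs_commg.
Qed.

(** Modulo [L j.+2], the commutator is bilinear on [L j] and [G], so commutators
    of generators generate [L j.+1]. *)
Lemma lcs_fg S j : finite_set S -> generates S ->
  exists X, [/\ finite_set X, X `<=` L j &
                L j `<=` subgroup_generated (X `|` L j.+1)].
Proof.
move=> finS genS; elim: j => [|j [X [finX XL LX]]].
  exists S; split=> // x _; apply: (generatesP genS).
    exact: subgroup_generated_subgroup.
  by move=> s Ss; apply: sub_subgroup_generated; left.
pose X' := [set [~ x, s] | x in X & s in S].
exists X'; split; first exact: finite_image2.
  by move=> _ [x Xx [s _ <-]]; apply: lcs_commg; apply: XL.
pose H := subgroup_generated (X' `|` L j.+2).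
have sH : is_subgroup H by exact: subgroup_generated_subgroup.
have [H1 HM HV] := sH.
have LH : L j.+2 `<=` H by move=> z Lz; apply: sub_subgroup_generated; right.
have HJ z g : L j.+1 z -> H z -> H (z ^ g).
  move=> Lz Hz; have -> : z ^ g = z * [~ z, g] by rewrite commgEl mulVKg.
  by apply: HM => //; apply: LH; apply: lcs_commg.
have HX x y : X x -> H [~ x, y].
  move=> Xx; move: y; apply: (generatesP (H := [set y | H [~ x, y]]) genS).
    split=> [|y z Hy Hz|y Hy] /=; first by rewrite commg1.
      by rewrite commgMJ; apply: HM => //; apply: HJ => //; apply: lcs_commg; apply: XL.
    by rewrite commgVJ; apply: HV; apply: HJ => //; apply: lcs_commg; apply: XL.
  by move=> s Ss /=; apply: sub_subgroup_generated; left; exists x => //; exists s.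
have HL x : L j x -> L j x /\ forall y, H [~ x, y].
  move=> /LX; move: x.
  apply: (subgroup_generated_min (H := [set x | L j x /\ forall y, H [~ x, y]])).
    have [L1 LM LV] := lcs_subgroup j.
    split=> [|x z [Lx Hx] [Lz Hz]|x [Lx Hx]]; split; try exact: LM; try exact: LV; try done.
    - by move=> y; rewrite comm1g.
    - by move=> y; rewrite commMgJ; apply: HM => //; apply: HJ => //; apply: lcs_commg.
    - by move=> y; rewrite commVgJ; apply: HV; apply: HJ => //; apply: lcs_commg.
  move=> x [Xx|Lx]; split; [exact: XL|by move=> y; apply: HX|exact: lcs_le|].
  by move=> y; apply: LH; apply: lcs_commg.
apply: subgroup_generated_min => // _ [x [y [/HL[_ Hx] ->]]]; exact: Hx.
Qed.

Lemma finite_set_of_quotient (Q : groupType) (pi : UMagmaMorphism.type G Q)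
    (H A : set G) : (forall q, exists x, pi x = q) -> (forall x, pi x = 1 <-> H x) ->
  finite_set H -> finite_set (pi @` A) -> finite_set A.
Proof.
move=> pi_surj piK finH finA; have [sec secK] := choice pi_surj.
apply: (@sub_finite_set _ _ [set sec q * h | q in pi @` A & h in H]); last first.
  exact: finite_image2.
move=> x Ax; exists (pi x); first by exists x.
exists ((sec (pi x))^-1 * x); last by rewrite mulVKg.
by apply/piK; rewrite gmulfM gmulfV secK mulVg.
Qed.

Lemma preim_subgroup (Q : groupType) (pi : UMagmaMorphism.type G Q) (U : set Q) :
  is_subgroup U -> is_subgroup (pi @^-1` U).
Proof.
case=> U1 UM UV; split=> [|x y Ux Uy|x Ux]; rewrite /preimage /=.
- by rewrite gmulf1.
- by rewrite gmulfM; apply: UM.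
- by rewrite gmulfV; apply: UV.
Qed.

(** Beyond the first, the factors of the lower central series are abelian,
    finitely generated and torsion, hence finite; by nilpotency there are
    finitely many of them. *)
Lemma finite_commutator_subgroup S :
  finite_set S -> generates S -> nilpotent_group G -> finite_set (L 1).
Proof.
move=> finS genS [c Lc].
suff : forall k j, (j + k = c)%N -> finite_set (L j.+1) by move/(_ c 0%N erefl).
elim=> [|k IHk] j.
  rewrite addn0 => ->; apply: (@sub_finite_set _ _ [set 1]); last exact: finite_set1.
  by rewrite -Lc; apply: lcs_le.
rewrite addnS -addSn => /IHk finL.
have [Q [pi [pi_surj piK pi_comm]]] := lcs_quotient j.+1.
apply: (finite_set_of_quotient pi_surj piK finL).
have [X [/finite_seqP[r ->] XL LX]] := lcs_fg j.+1 finS genS.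
pose s i := pi (nth 1 r i); pose n := size r.
have Ls i : (i < n)%N -> L j.+1 (nth 1 r i) by move=> lt_in; apply: XL; apply: mem_nth.
have s_comm i k' : (i < n)%N -> (k' < n)%N -> commute (s i) (s k').
  by move=> /Ls Li _; apply: pi_comm.
apply: (@sub_finite_set _ _ (range (powprod s n))); last first.
  apply: finite_range_powprod => i /Ls /lcs_torsion[m m0 /piK sm].
  by exists m; rewrite // -gmulfXn.
move=> _ [x /LX Lx <-]; move: x Lx; apply: subgroup_generated_min.
  exact/preim_subgroup/range_powprod_subgroup.
move=> x [|/piK pix1] /=; last first.
  by exists (fun=> 0%R) => //; rewrite powprod_eq0 // pix1.
move=> rx; exists (fun j => (j == index x r)%:Z)%R => //.
by rewrite powprod_delta ?index_mem // /s nth_index.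
Qed.

End LowerCentralSeries.

(** Modulo the torsion subset xy = yx means xy = y t x u with t and u torsion. *)
Lemma commg_torsion_of_abelian_quotient (G : groupType) (x y : G) :
  abelian_quotient (torsion G) ->
  exists t u, [/\ torsion G t, torsion G u & [~ x, y]%g = (t * u)%g].
Proof.
move=> abT; have T1 : torsion G 1%g by exists 1%N.
have : set_prod (coset_by (torsion G) y) (coset_by (torsion G) x) (x * y)%g.
  rewrite -(abT (coset_by _ x) (coset_by _ y)); [|by exists x|by exists y].
  by exists x; [exists 1%g; rewrite ?mulg1|exists y => //; exists 1%g; rewrite ?mulg1].
case=> _ [t [m [m0 tm]] <-] [_ [u Tu <-]] xy.
exists (t ^ x)%g, u; split=> //; first by exists m; rewrite -conjXg tm conj1g.
by rewrite commgEl !conjgE -xy -!mulgA mulKg.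
Qed.

(** * Finitely generated groups with finite commutator subgroup *)

Lemma injective_finite (T U : Type) (f : T -> U) (B : set U) :
  injective f -> range f `<=` B -> finite_set B -> finite_set [set: T].
Proof.
move=> f_inj fB finB; apply: (@sub_finite_set _ _ (f @^-1` B)).
  by move=> x _; apply: fB; exists x.
by apply: finite_preimage => // x y _ _; apply: f_inj.
Qed.

Lemma nat_collision (T : Type) (f : nat -> T) (B : set T) :
  range f `<=` B -> finite_set B -> exists a b, (a < b)%N /\ f a = f b.
Proof.
move=> fB finB; apply: contrapT => noab.
apply: infinite_nat; apply: (injective_finite _ fB finB) => a b fab.
by case: (ltngtP a b) => // ab; case: noab; [exists a, b|exists b, a].
Qed.

Lemma common_exponent (T : eqType) (A : set T) (P : T -> nat -> Prop) :
  finite_set A -> (forall x m k, P x m -> P x (m * k)%N) ->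
  (forall x, A x -> exists2 m, (0 < m)%N & P x m) ->
  exists2 m, (0 < m)%N & forall x, A x -> P x m.
Proof.
move=> /finite_seqP[r ->] PM; elim: r => [_|x r IHr Px]; first by exists 1%N.
have [|m m0 Pm] := IHr; first by move=> y yr; apply: Px; rewrite /= inE yr orbT.
have [|k k0 Pk] := Px x; first exact: mem_head.
exists (k * m)%N => [|y /=]; first by rewrite muln_gt0 k0.
rewrite inE => /orP[/eqP->|yr]; first exact: PM.
by rewrite mulnC; apply/PM/Pm.
Qed.

Section FiniteCommutatorSubgroup.
Local Open Scope group_scope.
Variable G : groupType.
Local Notation L1 := (@lower_central_series G 1).
Implicit Types (x y g : G) (S H : set G).

Lemma finite_subgroup_exponent H : is_subgroup H -> finite_set H ->
  exists2 e, (0 < e)%N & forall x, H x -> x ^+ e = 1.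
Proof.
move=> sH finH; apply: common_exponent => // [x m k|x Hx].
  by rewrite expgnA => ->; rewrite expg1n.
have [|a [b [ab xab]]] := nat_collision (f := fun n => x ^+ n) _ finH.
  by move=> _ [n _ <-]; apply: subgroupX.
by exists (b - a)%N; rewrite ?subn_gt0 // expgnFr 1?ltnW // xab mulgV.
Qed.

Hypothesis finL1 : finite_set L1.

(** The conjugates of y lie in the finite set y[G, G]. *)
Lemma commute_power x y : exists2 m, (0 < m)%N & commute (x ^+ m) y.
Proof.
have finB : finite_set [set y * c | c in L1] by exact: finite_image.
have [|a [b [ab yab]]] := nat_collision (f := fun n => y ^ (x ^+ n)) _ finB.
  move=> _ [n _ <-]; exists [~ y, x ^+ n]; first exact: lcs_commg.
  by rewrite commgEl mulVKg.
exists (b - a)%N; first by rewrite subn_gt0.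
apply/commute_sym/commgP/conjg_fixP; apply: (@conjg_inj _ (x ^+ a)).
by rewrite -conjgM -expgnDr subnK 1?ltnW.
Qed.

Lemma central_power S x : finite_set S -> generates S ->
  exists2 m, (0 < m)%N & forall y, commute (x ^+ m) y.
Proof.
move=> finS genS.
have [||m m0 xm] := @common_exponent _ S (fun y m => commute (x ^+ m) y) finS.
- by move=> y m k /commute_sym c; rewrite expgnA; apply/commute_sym/commuteX.
- by move=> y _; apply: commute_power.
exists m => //; apply: (generatesP (H := [set y | commute (x ^+ m) y]) genS) => //.
split; first exact: commute1.
  by move=> y z; apply: commuteM.
by move=> y; apply: commuteV.
Qed.

(** Let s_1, ..., s_n generate. The exponent vectors v for which
    s_1^v_1 ... s_n^v_n lies in [G, G] form a subgroup K of Z^n, and functionals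
    vanishing on K are homomorphisms from G to Z. Suitable powers of the s_i
    generate a central subgroup of finite index; raising them further makes
    this subgroup meet the common kernel of these homomorphisms trivially. *)
Lemma homs_to_int_and_finite_quotient S : finite_set S -> generates S ->
  exists r (psi : nat -> G -> int) (F : finGroupType) (phi : UMagmaMorphism.type G F),
    (forall j g h, (j < r)%N -> psi j (g * h) = (psi j g + psi j h)%R) /\
    (forall g, (forall j, (j < r)%N -> psi j g = 0%R) -> phi g = 1 -> g = 1).
Proof.
move=> finS genS; have /finite_seqP[l Sl] := finS.
pose s i := nth 1 l i; pose n := size l.
have Ss x : S x -> exists2 i, (i < n)%N & x = s i.
  by rewrite Sl => xl; exists (index x l); rewrite ?index_mem // /s nth_index.
have [m m0 sm] : exists2 m, (0 < m)%N & forall x, S x -> forall y, commute (x ^+ m) y.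
  apply: common_exponent => // [x m k xm y|x _]; last exact: central_power finS genS.
  by rewrite expgnA; apply/commute_sym/commuteX/commute_sym.
have [e e0 L1e] := finite_subgroup_exponent (lcs_subgroup G 1) finL1.
have {}sm i k y : (i < n)%N -> commute (s i ^+ (m * k)) y.
  move=> lt_in; rewrite expgnA; apply/commute_sym/commuteX/commute_sym/sm.
  by rewrite Sl; apply: mem_nth.
have [A [pi [pi_surj piK pi_comm]]] := lcs_quotient G 0.
pose P := powprod (pi \o s) n.
have piP v : pi (powprod s n v) = P v by apply: gmulf_powprod.
have pis_comm i j : (i < n)%N -> (j < n)%N -> commute ((pi \o s) i) ((pi \o s) j).
  by move=> _ _; apply: pi_comm.
have PL a v b w : P (combination a v b w) = zpow (P v) a * zpow (P w) b.
  by rewrite -(powprodZ pis_comm) -(powprodZ pis_comm) -(powprodD pis_comm).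
pose K := [set v | P v = 1].
have KL a v b w : K v -> K w -> K (combination a v b w).
  by rewrite /K /= PL => -> ->; rewrite !zpow1g mulg1.
have K0 v : (forall i, (i < n)%N -> v i = 0%R) -> K v by apply: powprod_eq0.
have [r [psi [d [d0 psiL psiK Kpsi]]]] := functionals_of_sublattice KL K0.
have psi_eq j v w : (j < r)%N -> P v = P w -> psi j v = psi j w.
  move=> jr vw; apply/eqP; rewrite -subr_eq0; apply/eqP.
  have := psiL j 1%R v (-1)%R w; rewrite mul1r mulN1r => <-; apply: psiK => //.
  by rewrite /K /= PL vw zpowN mulgV.
have [|vec vecP] := @choice _ _ (fun g v => pi g = P v).
  move=> g.
  have [v _ <-] : range P (pi g); last by exists v.
  apply: (generatesP (H := pi @^-1` range P) genS).
    exact/preim_subgroup/range_powprod_subgroup.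
  move=> _ /Ss[i lt_in ->]; exists (fun j => (j == i)%:Z)%R => //.
  by rewrite /P powprod_delta.
pose E := (m * (d * e))%N.
have E0 : (0 < E)%N by rewrite !muln_gt0 m0 d0.
have sE_comm i y : (i < n)%N -> commute (s i ^+ E) y by apply: sm.
pose B := range (powprod (fun i => s i ^+ E) n).
have sB : is_subgroup B.
  by apply: range_powprod_subgroup => i j lt_in _; apply: sE_comm.
have nB : normalised B.
  move=> _ g [v _ <-]; have /conjg_fixP-> : [~ powprod (fun i => s i ^+ E) n v, g] == 1.
    apply/commgP/commute_sym/commute_prod => i _; apply: commute_zpow.
    exact/commute_sym/sE_comm.
  by exists v.
have [Q [rho [rho_surj rhoK]]] := quotient_group_exists sB nB.
have finQ : finite_set [set: Q].
  apply: (@sub_finite_set _ _ [set x * y | x in range (powprod (rho \o s) n) & y in rho @` L1]).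
    move=> q _; have [g <-] := rho_surj q.
    exists (rho (powprod s n (vec g))); first by rewrite gmulf_powprod; exists (vec g).
    exists (rho ((powprod s n (vec g))^-1 * g)); last by rewrite -gmulfM mulVKg.
    by eexists; last reflexivity; apply/piK; rewrite gmulfM gmulfV piP vecP mulVg.
  apply: finite_image2; last exact: finite_image.
  apply: finite_range_powprod => i lt_in; exists E => //=.
  rewrite -gmulfXn; apply/rhoK; exists (fun j => (j == i)%:Z)%R => //.
  by rewrite powprod_delta.
have [F [f f_inj]] := finGroup_of_finite finQ.
exists r, (fun j g => psi j (vec g)), F, (f \o rho); split=> [j g h jr|g psi0 /eqP].
  have := psiL j 1%R (vec g) 1%R (vec h); rewrite !mul1r => <-; apply: psi_eq => //.
  by rewrite PL !zpow1 -!vecP gmulfM.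
rewrite /= gmulf_eq1 // => /eqP/rhoK[v _ gE].
have {}gE : g = powprod (fun i => s i ^+ m) n (fun i => e%:Z * (d%:Z * v i))%R.
  rewrite -gE !powprodX; apply: eq_powprod => i _.
  by rewrite /E !PoszM; ring.
have sm_comm i j : (i < n)%N -> (j < n)%N -> commute (s i ^+ m) (s j ^+ m).
  by move=> lt_in _; have := @sm i 1%N (s j ^+ m) lt_in; rewrite muln1.
rewrite gE (powprodMn sm_comm); apply: L1e; rewrite powprodX; apply/piK; rewrite piP.
suff : K (fun i => d%:Z * v i)%R.
  move=> Kv; have := KL (m%:Z)%R _ 0%R _ Kv Kv; congr (P _ = 1).
  by apply/funext => i; rewrite /combination mul0r addr0.
apply: Kpsi => j jr; have := psi0 j jr.
have -> : psi j (vec g) = psi j (combination (m * (e * d))%N%:Z v 0 v)%R.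
  apply: psi_eq => //; rewrite -vecP gE powprodX piP; apply: eq_powprod => i _.
  by rewrite /combination mul0r addr0 !PoszM !mulrA.
by rewrite psiL mul0r addr0 => /eqP; rewrite mulf_eq0 eqz_nat !muln_eq0 !gtn_eqF //= => /eqP.
Qed.

End FiniteCommutatorSubgroup.

(** * Words *)

Section Words.
Local Open Scope group_scope.
Variable G : groupType.
Implicit Types (S : set G) (g h : G) (w : seq G).

Lemma word_for1 S : word_for S 1 [::].
Proof. by split=> //; rewrite big_nil. Qed.

Lemma word_forM S g h w w' : word_for S g w -> word_for S h w' ->
  word_for S (g * h) (w ++ w').
Proof.
move=> [Sw <-] [Sw' <-]; split; last by rewrite big_cat.
by move=> s; rewrite mem_cat => /orP[/Sw|/Sw'].
Qed.

Lemma word_forV S g w : word_for S g w ->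
  word_for S g^-1 (rev [seq s^-1 | s <- w]).
Proof.
move=> [Sw <-]; split; last first.
  by rewrite -map_rev big_map prodgV revK.
move=> s; rewrite mem_rev => /mapP[x /Sw Sx ->]; rewrite invgK.
by case: Sx; [right|left].
Qed.

Lemma word_forX S g w M : word_for S g w ->
  exists2 w', word_for S (g ^+ M) w' & size w' = (M * size w)%N.
Proof.
move=> gw; elim: M => [|M [w' gw' sw']]; first by exists [::] => //; apply: word_for1.
by exists (w ++ w'); [rewrite expgS; apply: word_forM|rewrite size_cat sw'].
Qed.

Lemma exists_word S g : generates S -> exists w, word_for S g w.
Proof.
move=> genS; apply: (generatesP (H := [set g | exists w, word_for S g w]) genS).
  split=> [|x y [w xw] [w' yw]|x [w xw]]; first by exists [::]; apply: word_for1.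
    by exists (w ++ w'); apply: word_forM.
  by exists (rev [seq s^-1 | s <- w]); apply: word_forV.
move=> s Ss; exists [:: s]; split; last by rewrite big_seq1.
by move=> x; rewrite inE => /eqP->; left.
Qed.

Lemma word_length_le (R : realType) S g w : word_for S g w ->
  (word_length R S g <= (size w)%:R%:E)%E.
Proof. by move=> gw; apply: ext_min_le; exists w. Qed.

Lemma word_of_length_le (R : realType) S g n : generates S ->
  (word_length R S g <= n%:R%:E)%E -> exists2 w, word_for S g w & (size w <= n)%N.
Proof.
move=> genS; have [w0 gw0] := exists_word g genS.
rewrite /word_length.
have [|k [w gw <-] ->] := @ext_min_attained R [set size w | w in word_for S g].
  by exists (size w0), w0.
by rewrite lee_fin ler_nat => wn; exists w.
Qed.

Lemma hom_to_int_lipschitz S r (psi : nat -> G -> int) : finite_set S ->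
  (forall j g h, (j < r)%N -> psi j (g * h) = (psi j g + psi j h)%R) ->
  exists c, forall j g w, (j < r)%N -> word_for S g w ->
    (`|psi j g| <= c * size w)%N.
Proof.
move=> /finite_seqP[l ->] psiM.
exists (\max_(j < r) \max_(s <- l) `|psi j s|%N) => j g w jr [Sw <-].
set c := \max_(j < r) _.
have psi1 : psi j 1 = 0%R by have := psiM j 1 1 jr; rewrite mulg1; lia.
have psiV x : psi j x^-1 = (- psi j x)%R.
  by have := psiM j x x^-1 jr; rewrite mulgV psi1; lia.
have psi_l s : s \in l -> (`|psi j s| <= c)%N.
  move=> sl; apply: leq_trans (leq_bigmax_seq (F := fun s => `|psi j s|%N) s sl erefl) _.
  exact: (leq_bigmax (F := fun j : 'I_r => \max_(s <- l) `|psi j s|%N) (Ordinal jr)).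
elim: w Sw => [|s w IHw] Sw; first by rewrite big_nil psi1.
have {}IHw : (`|psi j (\prod_(x <- w) x)%g| <= c * size w)%N.
  by apply: IHw => x xw; apply: Sw; rewrite inE xw orbT.
have psi_s : (`|psi j s| <= c)%N.
  case: (Sw s (mem_head _ _)) => [/psi_l//|/psi_l].
  by rewrite psiV abszN.
have absD (a b : int) : (`|(a + b)%R| <= `|a| + `|b|)%N by lia.
rewrite big_cons psiM // mulnS; exact: leq_trans (absD _ _) (leq_add psi_s IHw).
Qed.

End Words.

(** * Growth bounds *)

Section GrowthBounds.
Variable R : realType.

Lemma ln2_ge_half : (1 / 2 <= ln (2 : R))%R.
Proof.
have := @le_ln1Dx R (- (1 / 2))%R; have -> : (1 + - (1 / 2) = 2^-1 :> R)%R by lra.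
rewrite lnV ?posrE // => /(_ ltac:(lra)); lra.
Qed.

Lemma ln_nat_le (a b : nat) : (0 < a <= b)%N -> (ln (a%:R : R) <= ln b%:R)%R.
Proof.
move=> /andP[a0 ab].
by rewrite ler_ln ?posrE ?ltr0n ?ler_nat // (leq_trans a0).
Qed.

Lemma nat_le_ln q m : (2 ^ q <= m)%N -> (q%:R <= 2 * ln (m%:R : R))%R.
Proof.
move=> qm; have : (ln (2 ^ q)%:R <= ln (m%:R : R))%R.
  by apply: ln_nat_le; rewrite expn_gt0.
rewrite natrX lnXn // -[(ln _ *+ q)%R]mulr_natl => qln.
have := ler_wpM2l (ler0n R q) ln2_ge_half; lra.
Qed.

Lemma divisibility_le (G : groupType) (g : G) (Q : finGroupType)
    (phi : {multiplicative G -> Q}) :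
  phi g <> 1%g -> (divisibility R g <= #|Q|%:R%:E)%E.
Proof. by move=> phig; apply: ext_min_le; exists Q, phi. Qed.

Lemma intr_Zp_eq0 q (a : int) : (1 < q)%N -> (a%:~R = 0 :> 'Z_q)%R -> (q %| `|a|)%N.
Proof.
move=> q1; rewrite {1}[a]intEsign rmorphM /= rmorphXn /= rmorphN1 => /eqP.
rewrite mulrI_eq0; last exact/lregX/lregN/lreg1.
move=> /eqP/(congr1 val); rewrite /= -pmulrn val_Zp_nat // => /eqP.
by rewrite /dvdn.
Qed.

(** Reduction modulo the least [q] that does not divide [psi g]; this [q] is
    logarithmic in [psi g]. *)
Lemma divisibility_le_hom_to_int (G : groupType) (psi : G -> int) (g : G) m :
  (forall x y, psi (x * y)%g = psi x + psi y)%R -> psi g != 0%R ->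
  (4 * `|psi g| <= m)%N -> (divisibility R g <= (2 * ln (m%:R : R))%:E)%E.
Proof.
move=> psiM psig gm; have M0 : (0 < `|psi g|)%N by rewrite absz_gt0.
have [q [q1 ndvd q2]] := exists_small_nondivisor M0.
pose f x : 'Z_q := ((psi x)%:~R)%R.
have fM : {morph (f : G -> 'Z_q) : x y / (x * y)%g}.
  by move=> x y; rewrite /f psiM rmorphD.
pose phi : {multiplicative G -> 'Z_q} :=
  HB.pack (f : G -> 'Z_q) (isMultiplicative.Build G 'Z_q f fM).
apply: (@le_trans _ _ (#|'Z_q|%:R%:E)%E).
  apply: (@divisibility_le _ g _ phi) => /(intr_Zp_eq0 q1).
  exact/negP.
rewrite card_ord Zp_cast // lee_fin; apply: nat_le_ln.
exact: leq_trans gm.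
Qed.

(** In a group of order at most 2^k the order of the image of z is itself at most
    2^k, so it divides the exponent and the power dies. *)
Lemma divisibility_common_multiple (G : groupType) (z : G) k :
  ((2 ^ k)%:R%:E <= divisibility R (z ^+ common_multiple k)%g)%E.
Proof.
apply: le_ereal_inf_tmp => _ [_ [Q [phi [phig ->]]] <-].
rewrite lee_fin ler_nat leqNgt; apply/negP => ltQ; case: phig.
have phiX n : phi (z ^+ n.+1)%g = (phi z ^+ n.+1)%g.
  by elim: n => // n IHn; rewrite expgS gmulfM IHn -expgS.
rewrite -(prednK (common_multiple_gt0 k)) phiX prednK ?common_multiple_gt0 //.
apply/eqP; rewrite -order_dvdn; apply: dvdn_common_multiple.
by rewrite order_gt0 (leq_trans (max_card _)) // ltnW.
Qed.

Lemma exists_double_exp n : exists k, (n < 4 ^ (2 ^ k))%N /\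
  ((0 < k)%N -> (4 ^ (2 ^ k.-1) <= n)%N).
Proof.
have exk : exists k, (n < 4 ^ (2 ^ k))%N.
  exists n; apply: (@leq_trans (2 ^ n)); first exact: ltn_expl.
  by rewrite (leq_trans (ltnW (ltn_expl (2 ^ n) (isT : 1 < 4)%N))).
case: (ex_minnP exk) => k kn kmin; exists k; split=> // k0.
by rewrite leqNgt; apply/negP => /kmin; rewrite -ltnS prednK // ltnn.
Qed.

End GrowthBounds.

(** * Logarithmic growth *)

Section LogarithmicGrowth.
Variables (R : realType) (N : groupType) (S : set N).
Hypotheses (finS : finite_set S) (genS : generates S).
Variables (r : nat) (psi : nat -> N -> int).
Variables (F : finGroupType) (phi : UMagmaMorphism.type N F).
Hypothesis psiM : forall j g h, (j < r)%N ->
  psi j (g * h)%g = (psi j g + psi j h)%R.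
Hypothesis psi_phi : forall g, (forall j, (j < r)%N -> psi j g = 0%R) ->
  phi g = 1%g -> g = 1%g.

Lemma rf_growth_le_log : growth_le (rf_growth R S) (log_growth R).
Proof.
have [c psi_lip] := hom_to_int_lipschitz finS psiM.
(* 4 c bounds 4 |psi g| / n, 2 |F| serves the elements killed by all psi, and
   the summand 2 keeps ln (C n) away from 0 when n = 1. *)
pose C := (4 * c + 2 * #|F| + 2)%N; have C0 : (0 < C)%N by rewrite /C addn2.
exists C; split=> //.
move=> n n0; have Cn : (0 < C * n)%N by rewrite muln_gt0 n0 C0.
apply: ge_ereal_sup => _ [g [g1 /(word_of_length_le genS)[w gw wn]] <-].
have ln_ge : (1 / 2 <= ln ((C * n)%:R : R))%R.
  apply: le_trans (ln2_ge_half R) (ln_nat_le R _).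
  by rewrite /= -[2]muln1 leq_mul // leq_addl.
rewrite /log_growth -EFinM.
have [psi0|] := pselect (forall j, (j < r)%N -> psi j g = 0%R).
  apply: (le_trans (@divisibility_le R _ g F phi _)); first by move/(psi_phi psi0).
  rewrite lee_fin; have CF : (2 * #|F|%:R <= C%:R :> R)%R by rewrite -natrM ler_nat /C; lia.
  apply: (@le_trans _ _ (C%:R * (1 / 2))%R); first lra.
  by rewrite ler_wpM2l.
case/existsNP => j /not_implyP[jr /eqP psig].
have psi_n := leq_trans (psi_lip j g w jr gw) (leq_mul (leqnn c) wn).
apply: le_trans (@divisibility_le_hom_to_int R N (psi j) g (C * n)%N _ psig _) _.
- by move=> x y; apply: psiM.
- by rewrite (leq_trans (leq_mul (leqnn 4) psi_n)) // mulnA leq_mul2r /C -addnA leq_addr orbT.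
rewrite lee_fin ler_wpM2r //; first by apply: le_trans ln_ge; lra.
by rewrite ler_nat leq_addl.
Qed.

Lemma log_le_rf_growth : infinite_set [set: N] ->
  growth_le (log_growth R) (rf_growth R S).
Proof.
move=> infN.
have [z [j [jr psiz]]] : exists z j, (j < r)%N /\ psi j z != 0%R.
  apply: contrapT => noz; apply: infN.
  have psi0 g j : (j < r)%N -> psi j g = 0%R.
    by move=> jr; apply: contra_notP noz => /eqP psig; exists g, j.
  apply: (@injective_finite _ _ phi [set: F]) => //; last exact: finite_finset.
  by apply: gmulf_inj => g; apply: psi_phi => j; apply: psi0.
have psiX M : psi j (z ^+ M)%g = (M%:Z * psi j z)%R.
  have psi1 : psi j 1%g = 0%R by have := psiM 1%g 1%g jr; rewrite mulg1; lia.
  by elim: M => [|M IHM]; rewrite ?mul0r // expgS psiM // IHM -addn1 PoszD mulrDl mul1r addrC.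
have zX M : (0 < M)%N -> (z ^+ M)%g <> 1%g.
  move=> M0 zM; have := psiX M; rewrite zM -(expg0 z) psiX mul0r => /esym/eqP.
  by rewrite mulf_eq0 (negbTE psiz) orbF eqz_nat gtn_eqF.
have [wz zwz] := exists_word z genS.
(* size wz is the length of z per unit of exponent; 6 = 3 * 2 accounts for
   ln 4 <= 3 and for 2^k <= 2 * 2^(k-1). *)
exists (size wz + 6)%N; split; first by rewrite addnS.
move=> n n0.
(* When k = 0, n is less than 4 and the exponent M is 1. *)
have [k [nk kn]] := exists_double_exp n.
set M := common_multiple k.-1.
have Mn : (M <= n)%N.
  rewrite /M; case: (k) kn => [//|k'] /(_ isT).
  exact/leq_trans/common_multiple_le.
have [w zw sw] := word_forX M zwz.
have growth_ge : ((2 ^ k.-1)%:R%:E <= rf_growth R S ((size wz + 6) * n)%N)%E.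
  apply: le_trans (divisibility_common_multiple R z k.-1) _.
  apply: ereal_sup_ubound; exists (z ^+ M)%g => //; split.
    exact/zX/common_multiple_gt0.
  apply: le_trans (word_length_le R zw) _; rewrite lee_fin ler_nat sw mulnC.
  by apply: leq_mul => //; rewrite leq_addr.
have C0 : (0 <= (size wz + 6)%:R%:E :> \bar R)%E by rewrite lee_fin.
apply: le_trans (lee_wpmul2l C0 growth_ge).
rewrite /log_growth -EFinM lee_fin -natrM.
have ln4 : (ln (4 : R) <= 3)%R.
  by have := @le_ln1Dx R 3; rewrite (_ : 1 + 3 = 4)%R; [apply; lra|lra].
have : (ln (n%:R : R) <= ln ((4 ^ 2 ^ k)%:R : R))%R by apply: ln_nat_le; rewrite n0 ltnW.
rewrite natrX lnXn // -[(ln _ *+ _)%R]mulr_natl => /le_trans; apply.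
apply: (@le_trans _ _ ((2 ^ k)%:R * 3)%R); first by rewrite ler_wpM2l.
rewrite -natrM ler_nat; apply: (@leq_trans (6 * 2 ^ k.-1)); last by rewrite leq_mul2r leq_addl orbT.
by case: (k) => //= k'; rewrite expnS; lia.
Qed.

End LogarithmicGrowth.

Theorem theorem1p1 (R : realType) (N : groupType)
    (N_inf : infinite_set [set: N]%classic)
    (N_fg : finitely_generated N)
    (N_nil : nilpotent_group N)
    (N_ab : abelian_quotient (torsion N)) :
  forall S : set N, finite_set S -> generates S ->
    growth_equiv (rf_growth R S) (log_growth R).
Proof.
move=> S finS genS.
have commT x y := commg_torsion_of_abelian_quotient x y N_ab.
have finL1 := finite_commutator_subgroup commT finS genS N_nil.
have [r [psi [F [phi [psiM psi_phi]]]]] :=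
  homs_to_int_and_finite_quotient finL1 finS genS.
split; first exact: (rf_growth_le_log R finS genS psiM psi_phi).
exact: (log_le_rf_growth R genS psiM psi_phi).
Qed.
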